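(* Let $V$ be the $2|1$-dimensional complex $\mathbb{Z}_2$-graded vector space with basis $v_1,v_2$ (even) and $v_3$ (odd), and let $d_{11}=\psi^{33}_3+\psi^{32}_2-\psi^{23}_2$. Then a miniversal deformation of $d_{11}$ is given by $$d^\infty=d_{11}+t\,\psi^{22}_3$$ with base $\mathbb{C}[[t]]$, and it is a jump deformation from $d_{11}$ to $d_1=\psi^{23}_2-\psi^{32}_2+\psi^{22}_3-\psi^{33}_3$: for every sufficiently small $t\in\mathbb{C}\setminus\{0\}$ the codifferential $d_{11}+t\psi^{22}_3$ is equivalent to $d_1$.
   Context: Notation: $\psi^{ij}_k:V\otimes V\to V$ is the linear map with $\psi^{ij}_k(v_a\otimes v_b)=v_k$ if $(a,b)=(i,j)$ and $0$ otherwise. A codifferential of degree 2 on $V$ is an odd linear map $d:V\otimes V\to V$ such that for all homogeneous $a,b,c$, $d(d(a,b),c)+(-1)^{|a|}d(a,d(b,c))=0$. Two codifferentials $d,d'$ are equivalent if $d'=g^{-1}\circ d\circ(g\otimes g)$ for some even linear automorphism $g$ of $V$. Deformations: a formal base is a (purely even) commutative unital $\mathbb{C}$-algebra $A$ with an augmentation $A\to\mathbb{C}$ whose kernel $\mathfrak m$ is the unique maximal ideal of $A$ (so $A=\mathbb{C}\oplus\mathfrak m$), and which is complete, $A=\varprojlim_k A/\mathfrak m^k$; it is infinitesimal if $\mathfrak m^2=0$. A deformation of $d$ with base $A$ is $d_A=d+\varphi$ with $\varphi:V\otimes V\to V\otimes\mathfrak m$ odd and $d_A$ (extended $A$-linearly)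 satisfying the codifferential identity. Deformations $d_A,d_A'$ are equivalent ($d_A\sim d'_A$) if $d_A'=g^{-1}\circ d_A\circ(g\otimes g)$ for some $A$-linear automorphism $g=I+\lambda$ with $\lambda:V\to V\otimes\mathfrak m$ even. A morphism $f:A\to B$ of augmented algebras pushes $d_A$ forward to $f_*(d_A)=(1\otimes f)d_A$. A deformation $d_A$ with formal base is versal if for every deformation $d_B$ with formal base $B$ there is a morphism $f:A\to B$ with $f_*(d_A)\sim d_B$; it is miniversal if moreover $f$ is unique whenever $B$ is infinitesimal. *)

(* Defs.v *)
(* Generic over a field; the complex numbers are [R[i]] with [R : realType]. *)
From HB Require Import structures.
From mathcomp Require Import all_boot all_order all_algebra.
From mathcomp Require Import boolp classical_sets reals.
From mathcomp Require Import complex mxtens.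

Set Implicit Arguments.
Unset Strict Implicit.
Unset Printing Implicit Defensive.

Import Order.TTheory GRing.Theory Num.Theory.
Local Open Scope ring_scope.
Local Open Scope classical_set_scope.

(* Formal power series, with the Cauchy product. The wrapper hides the
   pointwise ring structure carried by the function type [nat -> K]. *)
Record fps (K : Type) := Fps { fps_coef : nat -> K }.

Section FpsRing.
Context (K : comNzRingType).
Implicit Types a b c : fps K.

HB.instance Definition _ := gen_eqMixin (fps K).
HB.instance Definition _ := gen_choiceMixin (fps K).

Definition fps0 : fps K := Fps (fun=> 0).
Definition fps1 : fps K := Fps (fun n => (n == 0)%:R).
Definition fps_opp a : fps K := Fps (fun n => - fps_coef a n).
Definition fps_add a b : fps K := Fps (fun n => fps_coef a n + fps_coef b n).
Definition fps_mul a b : fps K :=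
  Fps (fun n => \sum_(i < n.+1) fps_coef a i * fps_coef b (n - i)).
Definition fps_scale (k : K) a : fps K := Fps (fun n => k * fps_coef a n).
Definition fpsX : fps K := Fps (fun n => (n == 1)%:R).

Lemma fpsP a b : (forall n, fps_coef a n = fps_coef b n) -> a = b.
Proof. by case: a b => [a] [b] /= /funext ->. Qed.

Fact fps_addA : associative fps_add.
Proof. by move=> a b c; apply: fpsP => n /=; rewrite addrA. Qed.
Fact fps_addC : commutative fps_add.
Proof. by move=> a b; apply: fpsP => n /=; rewrite addrC. Qed.
Fact fps_add0 : left_id fps0 fps_add.
Proof. by move=> a; apply: fpsP => n /=; rewrite add0r. Qed.
Fact fps_addN : left_inverse fps0 fps_opp fps_add.
Proof. by move=> a; apply: fpsP => n /=; rewrite addNr. Qed.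

HB.instance Definition _ :=
  GRing.isZmodule.Build (fps K) fps_addA fps_addC fps_add0 fps_addN.

Definition fps_trunc N a : {poly K} := \poly_(i < N) fps_coef a i.

Lemma fps_coef_mul N n a b : (n < N)%N ->
  fps_coef (fps_mul a b) n = (fps_trunc N a * fps_trunc N b)`_n.
Proof.
move=> ltnN; rewrite coefM /=; apply: eq_bigr => i _.
have lein : (i <= n)%N by rewrite -ltnS.
by rewrite !coef_poly (leq_ltn_trans lein ltnN)
  (leq_ltn_trans (leq_subr _ _) ltnN).
Qed.

Fact fps_mulC : commutative fps_mul.
Proof.
by move=> a b; apply: fpsP => n; rewrite !(fps_coef_mul _ _ (ltnSn n)) mulrC.
Qed.

Lemma fps_coef_mulA n a b c :
  fps_coef (fps_mul a (fps_mul b c)) n =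
  (fps_trunc n.+1 a * (fps_trunc n.+1 b * fps_trunc n.+1 c))`_n.
Proof.
rewrite coefM /=; apply: eq_bigr => i _.
have lei : (i < n.+1)%N by [].
have lej : (n - i < n.+1)%N by rewrite ltnS leq_subr.
by rewrite {1}coef_poly lei -(fps_coef_mul _ _ lej).
Qed.

Fact fps_mulA : associative fps_mul.
Proof.
move=> a b c; apply: fpsP => n.
by rewrite fps_coef_mulA [fps_mul (fps_mul a b) c]fps_mulC fps_coef_mulA
  [in RHS]mulrC mulrA.
Qed.

Fact fps_mul1 : left_id fps1 fps_mul.
Proof.
move=> a; apply: fpsP => n /=.
rewrite big_ord_recl /= mul1r subn0 big1 ?addr0 // => i _.
by rewrite /= mul0r.
Qed.

Fact fps_mulDl : left_distributive fps_mul fps_add.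
Proof.
move=> a b c; apply: fpsP => n /=; rewrite -big_split /=.
by apply: eq_bigr => i _; rewrite mulrDl.
Qed.

Fact fps_1neq0 : fps1 != 0.
Proof.
apply/eqP => /(congr1 (fun a => fps_coef a 0)) /= /eqP.
by rewrite oner_eq0.
Qed.

HB.instance Definition _ := GRing.Zmodule_isComNzRing.Build (fps K)
  fps_mulA fps_mulC fps_mul1 fps_mulDl fps_1neq0.

Fact fps_scaleA k l a : fps_scale k (fps_scale l a) = fps_scale (k * l) a.
Proof. by apply: fpsP => n /=; rewrite mulrA. Qed.
Fact fps_scale1 : left_id 1 fps_scale.
Proof. by move=> a; apply: fpsP => n /=; rewrite mul1r. Qed.
Fact fps_scaleDr : right_distributive fps_scale +%R.
Proof. by move=> k a b; apply: fpsP => n /=; rewrite mulrDr. Qed.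
Fact fps_scaleDl a : {morph fps_scale^~ a : k l / k + l}.
Proof. by move=> k l; apply: fpsP => n /=; rewrite mulrDl. Qed.

HB.instance Definition _ := GRing.Zmodule_isLmodule.Build K (fps K)
  fps_scaleA fps_scale1 fps_scaleDr fps_scaleDl.

Fact fps_scaleAl k a b : k *: (a * b) = (k *: a) * b.
Proof.
apply: fpsP => n /=; rewrite big_distrr /=.
by apply: eq_bigr => i _; rewrite mulrA.
Qed.

HB.instance Definition _ :=
  GRing.Lmodule_isLalgebra.Build K (fps K) fps_scaleAl.
HB.instance Definition _ := GRing.Lalgebra_isComAlgebra.Build K (fps K).

Definition fps_aug a : K^o := fps_coef a 0.

Fact fps_aug_linear : linear fps_aug.
Proof. by []. Qed.
HB.instance Definition _ :=
  GRing.isLinear.Build K (fps K) K^o _ fps_aug fps_aug_linear.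

Fact fps_aug_monoid_morphism : monoid_morphism fps_aug.
Proof.
by split=> [|a b] //; rewrite /fps_aug /= big_ord_recl big_ord0 addr0 subnn.
Qed.
HB.instance Definition _ :=
  GRing.isMonoidMorphism.Build (fps K) K^o fps_aug fps_aug_monoid_morphism.

End FpsRing.

Definition fps_eps (K : fieldType) : {lrmorphism fps K -> K^o} := @fps_aug K.

Section Ideals.
Context (A : comNzRingType).
Implicit Types I J M : set A.

Definition is_ideal I :=
  [/\ I 0, forall x y, I x -> I y -> I (x + y) & forall a x, I x -> I (a * x)].

Definition is_maximal_ideal M :=
  [/\ is_ideal M, ~ M 1 & forall J, is_ideal J -> ~ J 1 -> M `<=` J -> J = M].

Definition ideal_mul I J : set A := [set x | exists s : seq (A * A),
  (forall p, p \in s -> I p.1 /\ J p.2) /\ x = \sum_(p <- s) p.1 * p.2].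

Definition ideal_pow I k : set A := iter k (ideal_mul I) setT.

(* Injectivity and surjectivity of the canonical map from A to the inverse
   limit of the quotients A / I^k; an element of the limit is given by
   representatives [u k] of its components in A / I^k. *)
Definition adic_complete I :=
  (forall x, (forall k, ideal_pow I k x) -> x = 0) /\
  (forall u : nat -> A, (forall k, ideal_pow I k (u k.+1 - u k)) ->
     exists a, forall k, ideal_pow I k (a - u k)).

End Ideals.

Section FormalBase.
Context (K : fieldType).

Definition aug_ideal (A : comAlgType K) (eps : {lrmorphism A -> K^o}) : set A :=
  [set x | eps x = 0].

Definition is_formal_base (A : comAlgType K) (eps : {lrmorphism A -> K^o}) :=
  [/\ is_maximal_ideal (aug_ideal eps),
      forall M : set A, is_maximal_ideal M -> M = aug_ideal eps &
      adic_complete (aug_ideal eps)].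

Definition is_infinitesimal (A : comAlgType K) (eps : {lrmorphism A -> K^o}) :=
  ideal_pow (aug_ideal eps) 2 = [set 0].

Definition is_aug_morphism (A B : comAlgType K)
    (epsA : {lrmorphism A -> K^o}) (epsB : {lrmorphism B -> K^o})
    (f : {lrmorphism A -> B}) :=
  forall x, epsB (f x) = epsA x.

End FormalBase.

(* V has a basis indexed by ['I_n], the i-th vector having parity [par i]
   ([true] for odd). Elements of V (x) A are row vectors over A, and linear maps
   act by right multiplication by matrices; a linear map from V (x) V to V (x) A
   is a matrix with n * n rows, its A-linear extension being evaluated on
   a (x) b through the Kronecker product [*t]. *)
Section Cochains.
Context (n : nat) (par : 'I_n -> bool).

Definition cochain (A : Type) := 'M[A]_(n * n, n).

Definition psi (A : pzRingType) (i j k : 'I_n) : cochain A :=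
  delta_mx (mxtens_index (i, j)) k.

Section OverRing.
Context (A : comNzRingType).
Implicit Types (D : cochain A) (g h : 'M[A]_n) (a b c : 'rV[A]_n).

Definition bracket D a b : 'rV[A]_n := (a *t b) *m D.

Lemma bracket_psi (i j k r s : 'I_n) :
  bracket (psi A i j k) (delta_mx 0 r) (delta_mx 0 s) =
  if (r == i) && (s == j) then delta_mx 0 k else 0.
Proof.
apply/rowP => l; rewrite !mxE (bigD1 (mxtens_index (i, j))) //= big1.
  rewrite addr0 !mxE mxtens_indexK /= !eqxx (eq_sym i) (eq_sym j) /=.
  by case: (r == i); case: (s == j); rewrite /= ?(mul0r, mul1r, mulr0) ?mxE.
by move=> u /negPf une; rewrite [X in _ * X]mxE une mulr0.
Qed.

(* 0 is homogeneous of both parities. *)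
Definition homogeneous (e : bool) a := forall i, par i != e -> a 0 i = 0.

Definition odd_cochain D := forall e f a b,
  homogeneous e a -> homogeneous f b ->
  homogeneous (~~ (e (+) f)) (bracket D a b).

Definition even_map g := forall e a, homogeneous e a -> homogeneous e (a *m g).

Definition codiff_identity D := forall (e f h : bool) a b c,
  homogeneous e a -> homogeneous f b -> homogeneous h c ->
  bracket D (bracket D a b) c + (-1) ^+ e *: bracket D a (bracket D b c) = 0.

Definition is_codifferential D := odd_cochain D /\ codiff_identity D.

(* h is the inverse of g, so that D' = g^-1 o D o (g (x) g); composition reads
   from left to right since matrices act on row vectors. *)
Definition conjugates g D D' := exists h,
  [/\ g *m h = 1%:M, h *m g = 1%:M & D' = (g *t g) *m D *m h].

Definition codiff_equiv D D' :=
  [/\ is_codifferential D, is_codifferential D' &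
      exists2 g, even_map g & conjugates g D D'].

End OverRing.

Section Deformations.
Context (K : fieldType).

Definition is_deformation (A : comAlgType K) (eps : {lrmorphism A -> K^o})
    (d : cochain K) (dA : cochain A) :=
  is_codifferential d /\
  exists phi : cochain A,
    [/\ forall i j, aug_ideal eps (phi i j), odd_cochain phi,
        dA = map_mx (in_alg A) d + phi & codiff_identity dA].

Definition def_equiv (A : comAlgType K) (eps : {lrmorphism A -> K^o})
    (dA dA' : cochain A) :=
  exists lambda : 'M[A]_n,
    [/\ forall i j, aug_ideal eps (lambda i j), even_map lambda &
        conjugates (1%:M + lambda) dA dA'].

Definition push_forward (A B : comAlgType K) (f : {lrmorphism A -> B})
    (dA : cochain A) : cochain B := map_mx f dA.

Definition is_versal (A : comAlgType K) (eps : {lrmorphism A -> K^o})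
    (d : cochain K) (dA : cochain A) :=
  [/\ is_formal_base eps, is_deformation eps d dA &
    forall (B : comAlgType K) (epsB : {lrmorphism B -> K^o}) (dB : cochain B),
      is_formal_base epsB -> is_deformation epsB d dB ->
      exists2 f : {lrmorphism A -> B}, is_aug_morphism eps epsB f &
        def_equiv epsB (push_forward f dA) dB].

Definition is_miniversal (A : comAlgType K) (eps : {lrmorphism A -> K^o})
    (d : cochain K) (dA : cochain A) :=
  is_versal eps d dA /\
  forall (B : comAlgType K) (epsB : {lrmorphism B -> K^o}) (dB : cochain B),
    is_formal_base epsB -> is_infinitesimal epsB ->
    is_deformation epsB d dB ->
    forall f1 f2 : {lrmorphism A -> B},
      is_aug_morphism eps epsB f1 -> is_aug_morphism eps epsB f2 ->
      def_equiv epsB (push_forward f1 dA) dB ->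
      def_equiv epsB (push_forward f2 dA) dB ->
      f1 =1 f2.

End Deformations.
End Cochains.

Section Space21.

Definition v1 : 'I_3 := @Ordinal 3 0 isT.
Definition v2 : 'I_3 := @Ordinal 3 1 isT.
Definition v3 : 'I_3 := @Ordinal 3 2 isT.

Definition par21 (i : 'I_3) : bool := i == v3.

Definition d11 (K : pzRingType) : cochain 3 K :=
  psi K v3 v3 v3 + psi K v3 v2 v2 - psi K v2 v3 v2.

Definition d1 (K : pzRingType) : cochain 3 K :=
  psi K v2 v3 v2 - psi K v3 v2 v2 + psi K v2 v2 v3 - psi K v3 v3 v3.

Definition d_infty (K : comNzRingType) : cochain 3 (fps K) :=
  map_mx (in_alg (fps K)) (d11 K) + fpsX K *: psi (fps K) v2 v2 v3.

End Space21.

(* Main.v *)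
(* After the parity shift a |-> (-1)^(|a|+1) a in the first argument, odd
   codifferentials on V become associative products on the space with reversed
   parity, and d_11 + t psi^{22}_3 becomes e e = e, e x = x e = x, x x = - t e,
   with a third basis vector n annihilated by everything. Over a complete base a
   deformation of this algebra still contains an idempotent e spanning the
   one-dimensional component of v_3. Left and right multiplication by e are
   commuting idempotents that agree modulo the maximal ideal, hence they are
   equal, so e is central and the Peirce decomposition relative to e splits off
   a line spanned by some n with e n = n e = 0. Products of n with n and x are
   multiples of e killed by e, hence zero, and x x = - t e defines the parameter
   t. Over an infinitesimal base t is recovered as the coefficient of
   psi^{22}_3, which no equivalence changes since it lies in the square-zero
   ideal. For t <> 0 rescaling x by a square root of - 1 / t and changing the
   sign of e gives d_1. *)
Require Import Defs.
From mathcomp Require Import all_boot all_order all_algebra.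
From mathcomp Require Import boolp classical_sets reals.
From mathcomp Require Import complex mxtens.
From HB Require Import structures.
From mathcomp Require Import ring.
Set Implicit Arguments.
Unset Strict Implicit.
Unset Printing Implicit Defensive.

Import Order.TTheory GRing.Theory Num.Theory.
Local Open Scope ring_scope.
Local Open Scope complex_scope.

(** * Powers of ideals and adically complete rings *)

Section IdealPowers.
Context (A : comNzRingType).
Implicit Types I J : set A.

Lemma is_idealB {I} : is_ideal I -> forall x y, I x -> I y -> I (x - y).
Proof.
by case=> _ addI mulI x y Ix Iy; apply: addI => //; rewrite -mulN1r; apply: mulI.
Qed.

Lemma is_ideal_sum {I} (T : eqType) (s : seq T) (F : T -> A) :
  is_ideal I -> (forall i, i \in s -> I (F i)) -> I (\sum_(i <- s) F i).
Proof.
case=> I0 addI _; elim: s => [|i s IHs] Is; first by rewrite big_nil.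
rewrite big_cons; apply: addI; first by apply: Is; rewrite mem_head.
by apply: IHs => j js; apply: Is; rewrite in_cons js orbT.
Qed.

Lemma ideal_mul_is_ideal I J : is_ideal J -> is_ideal (ideal_mul I J).
Proof.
move=> [J0 _ mulJ]; split=> [|x y [s [sIJ ->]] [t [tIJ ->]]|a x [s [sIJ ->]]].
- by exists [::]; rewrite big_nil.
- exists (s ++ t); rewrite big_cat; split=> // p.
  by rewrite mem_cat => /orP[/sIJ|/tIJ].
- exists [seq (p.1, a * p.2) | p <- s]; split=> [_ /mapP[p /sIJ [Ip Jp] ->]|].
    by split=> //; apply: mulJ.
  by rewrite big_map mulr_sumr; apply: eq_bigr => p _; rewrite mulrCA.
Qed.

Lemma ideal_pow_is_ideal I k : is_ideal (ideal_pow I k).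
Proof. by elim: k => [|k IHk] //; apply: ideal_mul_is_ideal. Qed.

Lemma ideal_powS I k x y : I x -> ideal_pow I k y -> ideal_pow I k.+1 (x * y).
Proof.
move=> Ix Iy; exists [:: (x, y)]; rewrite big_seq1; split=> // p.
by rewrite inE => /eqP->.
Qed.

Lemma ideal_pow_exp I k x : I x -> ideal_pow I k (x ^+ k).
Proof. by move=> Ix; elim: k => [|k IHk] //; rewrite exprS; apply: ideal_powS. Qed.

Lemma ideal_pow_sub I k : is_ideal I -> (ideal_pow I k.+1 `<=` I)%classic.
Proof.
move=> idI _ [s [sI ->]]; apply: is_ideal_sum => // p /sI [Ip _].
by case: idI => _ _ mulI; rewrite mulrC; apply: mulI.
Qed.

(** The inverse is the geometric series in [x]: its partial sums converge adically, and (1 - x)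
    times the k-th partial sum is 1 - x^k. *)
Lemma adic_complete_unit I x : adic_complete I -> I x ->
  exists y, (1 - x) * y = 1.
Proof.
move=> [sepI complI] Ix.
have [k|y yP] := complI (fun k => \sum_(i < k) x ^+ i).
  by rewrite big_ord_recr /= addrAC subrr add0r; apply: ideal_pow_exp.
exists y; apply/eqP; rewrite -subr_eq0; apply/eqP/sepI => k.
have [_ addk mulk] := ideal_pow_is_ideal I k.
have -> : (1 - x) * y - 1 =
    (1 - x) * (y - \sum_(i < k) x ^+ i) + (- 1) * x ^+ k.
  have /eqP := subrX1 x k; rewrite subr_eq => /eqP ->; ring.
by apply: addk; apply: mulk; [apply: yP|apply: ideal_pow_exp].
Qed.

(* E = E^k has its entries in every power of I. *)
Lemma idempotent_mx_eq0 I n (E : 'M[A]_n) : adic_complete I ->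
  E *m E = E -> (forall i j, I (E i j)) -> E = 0.
Proof.
move=> [sepI _] EE IE; apply/matrixP => i j; rewrite mxE; apply: sepI => k.
elim: k i j => [|k IHk] i j //; rewrite -EE mxE.
by apply: is_ideal_sum => [|l _]; [apply: ideal_pow_is_ideal|apply: ideal_powS].
Qed.

Lemma ker_is_ideal (F : comNzRingType) (eps : {rmorphism A -> F}) :
  is_ideal [set x | eps x = 0]%classic.
Proof.
split=> [|x y /= x0 y0|a x /= x0] /=; first exact: rmorph0.
  by rewrite rmorphD x0 y0 addr0.
by rewrite rmorphM x0 mulr0.
Qed.

End IdealPowers.

(** * Evaluation of formal power series at an element of the ideal *)

Section FpsEvaluation.
Context (K : comNzRingType) (A : comAlgType K) (I : set A) (t : A).
Context (complI : adic_complete I) (It : I t).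
Implicit Types (a b : fps K) (p q : {poly K}).

(** Such a polynomial is divisible by X^k, so its value is a multiple of t^k. *)
Lemma horner_alg_ideal_pow k p : (forall i, (i < k)%N -> p`_i = 0) ->
  ideal_pow I k (horner_alg t p).
Proof.
move=> p0; rewrite -(poly_take_drop k p).
have -> : take_poly k p = 0.
  by apply/polyP => i; rewrite coef_take_poly coef0; case: ifP => // /p0.
rewrite add0r rmorphM rmorphXn /= horner_algX.
by case: (ideal_pow_is_ideal I k) => _ _; apply; apply: ideal_pow_exp.
Qed.

Lemma fps_coef_trunc N a i : (i < N)%N -> (fps_trunc N a)`_i = fps_coef a i.
Proof. by rewrite coef_poly => ->. Qed.

Lemma fps_eval_ex a :
  exists x, forall k, ideal_pow I k (x - horner_alg t (fps_trunc k a)).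
Proof.
apply: complI.2 => k; rewrite -rmorphB; apply: horner_alg_ideal_pow => i ltik.
by rewrite coefB !fps_coef_trunc ?subrr // ltnW.
Qed.

(** The limit of the values at [t] of the truncations of [a]. The choice is harmless: separatedness
    makes the limit unique. *)
Definition fps_eval a : A := sval (cid (fps_eval_ex a)).

Lemma fps_evalP a k : ideal_pow I k (fps_eval a - horner_alg t (fps_trunc k a)).
Proof. by rewrite /fps_eval; case: cid. Qed.

(** The approximating polynomials only have to agree with [a] in degrees below k. This freedom
    matters for products, since a product of truncations is not the truncation of the product. *)
Lemma fps_eval_unique a x :
  (forall k, exists2 p : {poly K}, forall i, (i < k)%N -> p`_i = fps_coef a i &
     ideal_pow I k (x - horner_alg t p)) -> fps_eval a = x.
Proof.
move=> xP; apply/eqP; rewrite -subr_eq0; apply/eqP/complI.1 => k.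
have [p pa xp] := xP k; have idk := ideal_pow_is_ideal I k.
have -> : fps_eval a - x = (fps_eval a - horner_alg t (fps_trunc k a)) +
    (horner_alg t (fps_trunc k a - p)) - (x - horner_alg t p).
  by rewrite rmorphB; ring.
apply: is_idealB => //; case: (idk) => _ addk _; apply: addk.
  exact: fps_evalP.
apply: horner_alg_ideal_pow => i ltik.
by rewrite coefB fps_coef_trunc // pa // subrr.
Qed.

Fact fps_eval_linear : linear fps_eval.
Proof.
move=> c a b; apply: fps_eval_unique => k.
exists (c *: fps_trunc k a + fps_trunc k b) => [i ltik|].
  by rewrite coefD coefZ !fps_coef_trunc.
have [_ addk mulk] := ideal_pow_is_ideal I k.
rewrite linearP /= opprD addrACA -[c *: fps_eval a]mulr_algl -mulrBr.
by apply: addk; first (apply: mulk); apply: fps_evalP.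
Qed.

Fact fps_eval_monoid_morphism : monoid_morphism fps_eval.
Proof.
split=> [|a b]; apply: fps_eval_unique => k.
  exists 1 => [i _|]; first by rewrite coef1.
  by rewrite rmorph1 subrr; case: (ideal_pow_is_ideal I k).
exists (fps_trunc k a * fps_trunc k b) => [i ltik|].
  by rewrite -(fps_coef_mul _ _ ltik).
have [_ addk mulk] := ideal_pow_is_ideal I k.
set u := fps_trunc k a; set v := fps_trunc k b.
have -> : fps_eval a * fps_eval b - horner_alg t (u * v) =
    fps_eval b * (fps_eval a - horner_alg t u) +
    horner_alg t u * (fps_eval b - horner_alg t v).
  by rewrite rmorphM; ring.
by apply: addk; apply: mulk; apply: fps_evalP.
Qed.

HB.instance Definition _ :=
  GRing.isLinear.Build K (fps K) A _ fps_eval fps_eval_linear.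
HB.instance Definition _ :=
  GRing.isMonoidMorphism.Build (fps K) A fps_eval fps_eval_monoid_morphism.

Lemma fps_evalX : fps_eval (fpsX K) = t.
Proof.
apply: fps_eval_unique => k; exists 'X => [i _|]; first by rewrite coefX.
by rewrite horner_algX subrr; case: (ideal_pow_is_ideal I k).
Qed.

(** Evaluation preserves constant terms modulo the ideal; this makes it a morphism of augmented
    algebras. *)
Lemma fps_eval_coef0 a : ideal_pow I 1 (fps_eval a - (fps_coef a 0)%:A).
Proof.
have := fps_evalP a 1; rewrite /fps_trunc poly_def big_ord1 expr0.
by rewrite linearZ /= rmorph1 mulr1.
Qed.

End FpsEvaluation.

(** * The power series ring as a formal base *)

Section FpsFormalBase.
Context (K : fieldType).
Implicit Types a b : fps K.
Let m : set (fps K) := aug_ideal (fps_eps K).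

Lemma fps_coefX a n :
  fps_coef (fpsX K * a) n = if n is n'.+1 then fps_coef a n' else 0.
Proof.
rewrite [LHS]/=; case: n => [|n]; first by rewrite big_ord1 mul0r.
rewrite !big_ord_recl /= mul0r add0r mul1r subSS subn0 big1 ?addr0 // => i _.
by rewrite mul0r.
Qed.

Lemma aug_ideal_powP k a :
  ideal_pow m k a <-> forall i, (i < k)%N -> fps_coef a i = 0.
Proof.
elim: k a => [|k IHk] a; first by split.
split=> [[s [sm ->]]|a0].
  (* The series of order at least k + 1 form an ideal, so it suffices to treat each product in the
     sum. *)
  apply: (is_ideal_sum (s := s) (F := fun p => p.1 * p.2)
    (I := [set a | forall i, (i < k.+1)%N -> fps_coef a i = 0]%classic)).
    split=> [|b c b0 c0|c b b0] i ltik //=; first by rewrite b0 ?c0 ?addr0.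
    rewrite big1 // => j _; rewrite b0 ?mulr0 //.
    exact: leq_ltn_trans (leq_subr _ _) ltik.
  move=> [b c] /sm [/= b0 /IHk c0] [|i] lti.
    by rewrite /= big_ord1 (b0 : fps_coef b 0 = 0) mul0r.
  rewrite /= big_ord_recl (b0 : fps_coef b 0 = 0) mul0r add0r big1 // => j _.
  by rewrite c0 ?mulr0 //= subSS (leq_ltn_trans (leq_subr _ _)).
(* Conversely, a series without constant term is X times its shift, whose order is one less. *)
have -> : a = fpsX K * Fps (fun i => fps_coef a i.+1).
  by apply: fpsP => -[|i]; rewrite fps_coefX // a0.
by apply: ideal_powS => //; apply/IHk => i ltik /=; apply: a0.
Qed.

Lemma fps_adic_complete : adic_complete m.
Proof.
split=> [a a0|u uP].
  by apply: fpsP => n; apply: ((aug_ideal_powP n.+1 a).1 (a0 _)).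
(* As u (k+1) - u k has order at least k, coefficient i no longer changes from the index i + 1 on;
   the limit collects these stable values. *)
have uE i k : (i < k)%N -> fps_coef (u k) i = fps_coef (u i.+1) i.
  elim: k => // k IHk; rewrite ltnS leq_eqVlt => /predU1P[->//|ltik].
  rewrite -(IHk ltik); apply/eqP; rewrite -subr_eq0; apply/eqP.
  exact: ((aug_ideal_powP k _).1 (uP k)).
exists (Fps (fun i => fps_coef (u i.+1) i)) => k; apply/aug_ideal_powP => i ltik.
by rewrite /= (uE _ _ ltik) subrr.
Qed.

Lemma ideal_aug_unit (J : set (fps K)) a : is_ideal J -> J a ->
  fps_coef a 0 != 0 -> J 1.
Proof.
move=> [_ _ mulJ] Ja a0.
(* Divided by its constant term, [a] becomes 1 minus an element of the maximal ideal, hence a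
   unit. *)
have [|y yP] := adic_complete_unit (x := 1 - (fps_coef a 0)^-1 *: a)
    fps_adic_complete.
  by rewrite /m /aug_ideal /= /fps_aug /= mulVf // subrr.
by rewrite -yP mulrC opprB addrC subrK -mulr_algl mulrA; apply: mulJ.
Qed.

(** Every proper ideal lies in the augmentation ideal, because a series outside it is a unit; this
    gives both maximality and uniqueness. *)
Lemma fps_is_formal_base : is_formal_base (fps_eps K).
Proof.
have idm : is_ideal m := ker_is_ideal (fps_eps K).
have max J : is_ideal J -> ~ J 1 -> (J `<=` m)%classic.
  move=> idJ J1 a Ja; apply/eqP/negPn/negP => a0.
  by apply: J1; apply: ideal_aug_unit Ja a0.
have m1 : ~ m 1 by move/eqP; rewrite /= oner_eq0.
split; last exact: fps_adic_complete.
  split=> // J idJ J1 mJ; apply/seteqP; split=> //; exact: max.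
move=> M [idM M1 maxM]; apply/esym/maxM => //; exact: max.
Qed.

End FpsFormalBase.

(** * Bilinear calculus of brackets *)

Lemma mulmx_rV_inj (A : nzRingType) (m n : nat) (M N : 'M[A]_(m, n)) :
  (forall a : 'rV_m, a *m M = a *m N) -> M = N.
Proof. by move=> MN; apply/row_matrixP => i; rewrite !rowE. Qed.

Section Bracket.
Context (n : nat) (A : comNzRingType).
Implicit Types (C D : cochain n A) (a b c : 'rV[A]_n) (g h : 'M[A]_n).

Fact bracket_linear D a : linear (bracket D a).
Proof.
move=> k b c; rewrite /bracket scalemxAl -mulmxDl; congr (_ *m D).
by apply/matrixP => i j; rewrite !mxE mulrDr mulrCA.
Qed.
HB.instance Definition _ D a :=
  GRing.isLinear.Build A 'rV[A]_n 'rV[A]_n _ (bracket D a) (bracket_linear D a).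

(** The arguments are swapped so that linearity in the first one can be declared as an instance, and
    right multiplication can be turned into a matrix. *)
Definition bracketr D b a := bracket D a b.

Fact bracketr_linear D b : linear (bracketr D b).
Proof.
move=> k a c; rewrite /bracketr /bracket scalemxAl -mulmxDl; congr (_ *m D).
by apply/matrixP => i j; rewrite !mxE mulrDl mulrA.
Qed.
HB.instance Definition _ D b :=
  GRing.isLinear.Build A 'rV[A]_n 'rV[A]_n _ (bracketr D b) (bracketr_linear D b).

Lemma bracketDl D a b c : bracket D (a + b) c = bracket D a c + bracket D b c.
Proof. exact: (linearD (bracketr D c)). Qed.

Lemma bracketZl D k a c : bracket D (k *: a) c = k *: bracket D a c.
Proof. exact: (linearZ_LR (bracketr D c)). Qed.

Lemma bracketDr D a b c : bracket D a (b + c) = bracket D a b + bracket D a c.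
Proof. exact: linearD. Qed.

Lemma bracketZr D k a c : bracket D a (k *: c) = k *: bracket D a c.
Proof. exact: linearZ_LR. Qed.

Lemma bracketDmx C D a b : bracket (C + D) a b = bracket C a b + bracket D a b.
Proof. exact: mulmxDr. Qed.

Lemma bracketNmx D a b : bracket (- D) a b = - bracket D a b.
Proof. exact: mulmxN. Qed.

Lemma bracketZmx k D a b : bracket (k *: D) a b = k *: bracket D a b.
Proof. by rewrite /bracket -scalemxAr. Qed.

Lemma bracket_mulmx D g a b : bracket (D *m g) a b = bracket D a b *m g.
Proof. exact: mulmxA. Qed.

Lemma bracket_tensmx D g h a b :
  bracket ((g *t h) *m D) a b = bracket D (a *m g) (b *m h).
Proof. by rewrite /bracket mulmxA tensmx_mul. Qed.

Lemma bracket_delta D i j :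
  bracket D (delta_mx 0 i) (delta_mx 0 j) = row (mxtens_index (i, j)) D.
Proof.
rewrite rowE; congr (_ *m D); apply/matrixP => k l.
case: (mxtens_indexP l) => i' j'; rewrite !mxE mxtens_indexK /=.
rewrite !ord1 !eqxx /= -natrM mulnb.
by rewrite (inj_eq (can_inj (@mxtens_indexK _ _))).
Qed.

Lemma cochain_ext C D : (forall i j, bracket C (delta_mx 0 i) (delta_mx 0 j) =
  bracket D (delta_mx 0 i) (delta_mx 0 j)) -> C = D.
Proof.
move=> CD; apply/row_matrixP => k; case: (mxtens_indexP k) => i j.
by rewrite -!bracket_delta.
Qed.

Lemma bracket_psiE i j k a b :
  bracket (psi A i j k) a b = (a 0 i * b 0 j) *: delta_mx 0 k.
Proof.
apply/rowP => l; rewrite mxE (bigD1 (mxtens_index (i, j))) //= big1 => [|u /negPf une].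
  by rewrite addr0 !mxE mxtens_indexK /= !ord1 !eqxx.
by rewrite [X in _ * X]mxE une mulr0.
Qed.

Lemma map_bracket (F : comNzRingType) (f : {rmorphism A -> F}) D a b :
  map_mx f (bracket D a b) = bracket (map_mx f D) (map_mx f a) (map_mx f b).
Proof.
rewrite /bracket map_mxM; congr (_ *m _).
by apply/matrixP => i j; rewrite !mxE rmorphM.
Qed.

End Bracket.

(** * Parity and the shift to associative products *)

Section Graded.
Context (n : nat) (par : 'I_n -> bool) (A : comNzRingType).
Implicit Types (C D : cochain n A) (a b c : 'rV[A]_n) (g h : 'M[A]_n).

Lemma homogeneousD e a b :
  homogeneous par e a -> homogeneous par e b -> homogeneous par e (a + b).
Proof. by move=> ha hb i ie; rewrite mxE ha // hb // addr0. Qed.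

Lemma homogeneousZ e k a : homogeneous par e a -> homogeneous par e (k *: a).
Proof. by move=> ha i ie; rewrite mxE ha // mulr0. Qed.

Lemma homogeneousB e a b :
  homogeneous par e a -> homogeneous par e b -> homogeneous par e (a - b).
Proof.
by move=> ha hb; rewrite -scaleN1r; apply: homogeneousD => //; apply: homogeneousZ.
Qed.

Lemma homogeneous_delta i : homogeneous par (par i) (delta_mx 0 i : 'rV[A]_n).
Proof.
by move=> j; rewrite mxE eqxx /=; case: (eqVneq j i) => [->|//]; rewrite eqxx.
Qed.

Lemma homogeneous_both e a :
  homogeneous par e a -> homogeneous par (~~ e) a -> a = 0.
Proof.
move=> ha ha'; apply/rowP => i; rewrite mxE.
by case: (eqVneq (par i) e) => [ie|/ha //]; apply: ha'; rewrite ie; case: (e).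
Qed.

Definition part e a : 'rV[A]_n := \row_i (if par i == e then a 0 i else 0).

Lemma part_homogeneous e a : homogeneous par e (part e a).
Proof. by move=> i /negPf ie; rewrite mxE ie. Qed.

Lemma part_sum e a : a = part e a + part (~~ e) a.
Proof.
by apply/rowP => i; rewrite !mxE; case: (par i); case: e; rewrite /= ?addr0 ?add0r.
Qed.

(** Let p and q be the components of a g of right and wrong parity. Then q h = a - p h has both
    parities, so it vanishes, and q = 0 because [h] is invertible. *)
Lemma even_map_inv g h : g *m h = 1%:M -> h *m g = 1%:M ->
  even_map par h -> even_map par g.
Proof.
move=> gh hg evh e a ha.
have := part_sum e (a *m g); set p := part e _; set q := part (~~ e) _ => agE.
have hp : homogeneous par e p by apply: part_homogeneous.
have hq : homogeneous par (~~ e) q by apply: part_homogeneous.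
suff q0 : q = 0 by rewrite agE q0 addr0.
have : q *m h = 0.
  apply: (@homogeneous_both e); last exact: evh.
  have -> : q *m h = a - p *m h.
    by rewrite -[a in RHS]mulmx1 -gh mulmxA agE mulmxDl addrC addKr.
  by apply: homogeneousB => //; apply: evh.
by move/(congr1 (mulmx^~ g)); rewrite /= -mulmxA hg mulmx1 mul0mx.
Qed.

Lemma even_mapP g :
  even_map par g <-> forall i j, par i != par j -> g i j = 0.
Proof.
split=> [evg i j ij|g0 e a ha j je].
  have /(_ j) := evg _ _ (@homogeneous_delta i).
  by rewrite -rowE mxE eq_sym; apply.
rewrite mxE big1 // => i _; have [ie|ie] := eqVneq (par i) e.
  by rewrite g0 ?mulr0 // ie eq_sym.
by rewrite ha ?mul0r.
Qed.

(** The involution a |-> (-1)^(|a|+1) a; the exponent [~~ par i] is the reversed parity of the i-th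
    basis vector. *)
Definition shift_mx : 'M[A]_n := diag_mx (\row_i (-1) ^+ (~~ par i)).

Lemma shift_mxK : shift_mx *m shift_mx = 1%:M.
Proof.
rewrite mulmx_diag -diag_const_mx; congr diag_mx.
by apply/rowP => i; rewrite !mxE -signr_addb addbb.
Qed.

Lemma mul_shift_mx e a : homogeneous par e a ->
  a *m shift_mx = (-1 : A) ^+ (~~ e) *: a.
Proof.
move=> ha; apply/rowP => i; rewrite mul_mx_diag !mxE mulrC.
by have [->//|/ha ->] := eqVneq (par i) e; rewrite !mulr0.
Qed.

Lemma even_map_shift g : even_map par g -> g *m shift_mx = shift_mx *m g.
Proof.
move/even_mapP => g0; apply/matrixP => i j.
rewrite mul_mx_diag mul_diag_mx !mxE mulrC.
by have [->//|/g0 ->] := eqVneq (par i) (par j); rewrite !mulr0.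
Qed.

(* Parity shift: on the space with reversed parity, an odd cochain becomes an
   even product, and the codifferential identity becomes associativity. *)
Definition shift D : cochain n A := (shift_mx *t 1%:M) *m D.

Lemma bracket_shift D a b : bracket (shift D) a b = bracket D (a *m shift_mx) b.
Proof. by rewrite bracket_tensmx mulmx1. Qed.

Lemma bracket_shift_homogeneous e D a b : homogeneous par e a ->
  bracket (shift D) a b = (-1 : A) ^+ (~~ e) *: bracket D a b.
Proof. by move=> ha; rewrite bracket_shift (mul_shift_mx ha) bracketZl. Qed.

Lemma shift_odd D : odd_cochain par D -> odd_cochain par (shift D).
Proof.
move=> oddD e f a b ha hb; rewrite (bracket_shift_homogeneous _ _ ha).
by apply: homogeneousZ; apply: oddD.
Qed.

Lemma shift_assoc D a b c : odd_cochain par D -> codiff_identity par D ->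
  bracket (shift D) (bracket (shift D) a b) c =
  bracket (shift D) a (bracket (shift D) b c).
Proof.
move=> oddD codD.
have assoc_hom (e f k : bool) a' b' c' : homogeneous par e a' -> homogeneous par f b' ->
    homogeneous par k c' ->
    bracket (shift D) (bracket (shift D) a' b') c' =
    bracket (shift D) a' (bracket (shift D) b' c').
  move=> ha hb hc; rewrite (bracket_shift_homogeneous _ _ (shift_odd oddD ha hb)).
  rewrite !(bracket_shift_homogeneous _ _ ha) (bracket_shift_homogeneous _ _ hb).
  rewrite bracketZl bracketZr !scalerA.
  (* The codifferential identity contributes the sign -(-1)^e, which turns the left sign (-1)^(f+1)
     into the right one, (-1)^(e+f). *)
  have /eqP := codD _ _ _ _ _ _ ha hb hc; rewrite addr_eq0 => /eqP ->.
  rewrite scalerN -scaleNr scalerA; congr (_ *: _).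
  by case: (e); case: (f); rewrite /= ?expr0 ?expr1; ring.
(* Homogeneity is now dropped one argument at a time, from the last to the first, by splitting into
   even and odd parts. *)
have assoc_ab (e f : bool) a' b' c' : homogeneous par e a' -> homogeneous par f b' ->
    bracket (shift D) (bracket (shift D) a' b') c' =
    bracket (shift D) a' (bracket (shift D) b' c').
  move=> ha hb; rewrite [c'](part_sum true) !bracketDr.
  by congr (_ + _); apply: (assoc_hom _ _ _ _ _ _ ha hb); apply: part_homogeneous.
have assoc_a (e : bool) a' b' c' : homogeneous par e a' ->
    bracket (shift D) (bracket (shift D) a' b') c' =
    bracket (shift D) a' (bracket (shift D) b' c').
  move=> ha; rewrite [b'](part_sum true) !(bracketDl, bracketDr).
  by congr (_ + _); apply: (assoc_ab _ _ _ _ _ ha); apply: part_homogeneous.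
rewrite [a](part_sum true) !bracketDl.
by congr (_ + _); apply: assoc_a; apply: part_homogeneous.
Qed.

End Graded.

(** * The two-parameter family spanned by d_11 and psi^{22}_3 *)

Lemma ord3P (P : 'I_3 -> Prop) : P v1 -> P v2 -> P v3 -> forall i, P i.
Proof.
move=> P1 P2 P3 [[|[|[|//]]] lti].
- by rewrite (_ : Ordinal lti = v1) //; apply: val_inj.
- by rewrite (_ : Ordinal lti = v2) //; apply: val_inj.
- by rewrite (_ : Ordinal lti = v3) //; apply: val_inj.
Qed.

Section Pencil.
Context (A : comNzRingType).
Implicit Types (s t : A) (a b c : 'rV[A]_3).

(** One family for all cochains at hand: (1, t) gives d_11 + t psi^{22}_3, (-1, 1) gives d_1, and
    (0, t) gives t psi^{22}_3 alone. *)
Definition pencil s t : cochain 3 A := s *: d11 A + t *: psi A v2 v2 v3.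

Lemma pencil_d11 t : d11 A + t *: psi A v2 v2 v3 = pencil 1 t.
Proof. by rewrite /pencil scale1r. Qed.

Lemma d11_pencil : d11 A = pencil 1 0.
Proof. by rewrite -pencil_d11 scale0r addr0. Qed.

Lemma bracket_pencil s t a b : bracket (pencil s t) a b =
  (s * (a 0 v3 * b 0 v2 - a 0 v2 * b 0 v3)) *: delta_mx 0 v2 +
  (s * (a 0 v3 * b 0 v3) + t * (a 0 v2 * b 0 v2)) *: delta_mx 0 v3.
Proof.
rewrite /pencil /d11 !(bracketDmx, bracketNmx, bracketZmx, bracket_psiE).
by apply/rowP; apply: ord3P; rewrite !mxE /=; ring.
Qed.

Lemma bracket_pencil_coord s t a b (D := pencil s t) :
  [/\ bracket D a b 0 v1 = 0,
      bracket D a b 0 v2 = s * (a 0 v3 * b 0 v2 - a 0 v2 * b 0 v3) &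
      bracket D a b 0 v3 = s * (a 0 v3 * b 0 v3) + t * (a 0 v2 * b 0 v2)].
Proof. by rewrite /D bracket_pencil; split; rewrite !mxE /=; ring. Qed.

Lemma homogeneous21E e a : homogeneous par21 e a <->
  if e then a 0 v1 = 0 /\ a 0 v2 = 0 else a 0 v3 = 0.
Proof.
case: e; split=> [ha|].
- by split; apply: ha.
- by case=> a1 a2; apply: ord3P.
- exact: ha.
- by move=> a3; apply: ord3P.
Qed.

Lemma pencil_odd s t : odd_cochain par21 (pencil s t).
Proof.
move=> e f a b /homogeneous21E ha /homogeneous21E hb; apply/homogeneous21E.
have [-> -> ->] := bracket_pencil_coord s t a b.
case: e ha => [[a1 a2]|a3]; case: f hb => [[b1 b2]|b3] /=.
- by rewrite a2 b2; split=> //; ring.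
- by rewrite a2 b3; ring.
- by rewrite a3 b2; ring.
- by rewrite a3 b3; split=> //; ring.
Qed.

(** The parity of [a] fixes the sign and kills its v_2 or its v_3 coordinate; what remains is a
    polynomial identity in the coordinates. *)
Lemma pencil_codiff s t : is_codifferential par21 (pencil s t).
Proof.
split=> [|e f h a b c /homogeneous21E ha _ _]; first exact: pencil_odd.
have [L1 L2 L3] := bracket_pencil_coord s t (bracket (pencil s t) a b) c.
have [R1 R2 R3] := bracket_pencil_coord s t a (bracket (pencil s t) b c).
have [ab1 ab2 ab3] := bracket_pencil_coord s t a b.
have [bc1 bc2 bc3] := bracket_pencil_coord s t b c.
apply/rowP; apply: ord3P; rewrite [LHS]mxE [X in _ + X]mxE [RHS]mxE.
- by rewrite L1 R1 mulr0 addr0.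
- rewrite L2 R2 ab2 ab3 bc2 bc3.
  by case: e ha => [[_ ->]|->]; rewrite ?expr0 ?expr1; ring.
- rewrite L3 R3 ab2 ab3 bc2 bc3.
  by case: e ha => [[_ ->]|->]; rewrite ?expr0 ?expr1; ring.
Qed.

Lemma psi223_odd t : odd_cochain par21 (t *: psi A v2 v2 v3).
Proof. by have := pencil_odd 0 t; rewrite /pencil scale0r add0r. Qed.

Lemma bracket_shift_pencil s t a b : bracket (shift par21 (pencil s t)) a b =
  (s * (a 0 v3 * b 0 v2 + a 0 v2 * b 0 v3)) *: delta_mx 0 v2 +
  (s * (a 0 v3 * b 0 v3) - t * (a 0 v2 * b 0 v2)) *: delta_mx 0 v3.
Proof.
rewrite bracket_shift bracket_pencil !mul_mx_diag !mxE /= expr0 expr1.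
by congr (_ *: _ + _ *: _); ring.
Qed.

(** Commutativity of the undeformed product makes left and right multiplication by an element agree
    modulo the ideal. *)
Lemma bracket_shift_pencilC s t a b :
  bracket (shift par21 (pencil s t)) a b = bracket (shift par21 (pencil s t)) b a.
Proof. by rewrite !bracket_shift_pencil; congr (_ *: _ + _ *: _); ring. Qed.

End Pencil.

Lemma map_pencil (A B : comNzRingType) (f : {rmorphism A -> B}) s t :
  map_mx f (pencil s t) = pencil (f s) (f t).
Proof. by rewrite !(map_mxD, map_mxN, map_mxZ, map_delta_mx). Qed.

Lemma map_shift n (par : 'I_n -> bool) (A B : comNzRingType)
    (f : {rmorphism A -> B}) (D : cochain n A) :
  map_mx f (shift par D) = shift par (map_mx f D).
Proof.
rewrite map_mxM; congr (_ *m _); apply/matrixP => i j.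
by rewrite !mxE rmorphM !rmorphMn rmorphXn rmorphN1 rmorph1.
Qed.

(** * Normal form of a deformation over a complete base *)

Section NormalForm.
Context (A F : comNzRingType) (eps : {rmorphism A -> F}).
Context (complA : adic_complete [set x | eps x = 0]%classic).

(** For commuting idempotents, M - M N is again idempotent. If M and N agree modulo the ideal, its
    entries lie there, so it is zero; exchanging M and N gives M = M N = N. *)
Lemma commuting_idempotent_mx_eq n (L R : 'M[A]_n) : L *m L = L -> R *m R = R ->
  L *m R = R *m L -> map_mx eps L = map_mx eps R -> L = R.
Proof.
have half (M N : 'M[A]_n) : M *m M = M -> N *m N = N -> M *m N = N *m M ->
    map_mx eps M = map_mx eps N -> M = M *m N.
  move=> MM NN MN eMN; apply/eqP; rewrite -subr_eq0; apply/eqP.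
  apply: (idempotent_mx_eq0 complA) => [|i j].
    have e1 : M *m (M *m N) = M *m N by rewrite mulmxA MM.
    have e2 : M *m N *m M = M *m N by rewrite -mulmxA -MN e1.
    have e3 : M *m N *m (M *m N) = M *m N by rewrite mulmxA e2 -mulmxA NN.
    by rewrite mulmxBl !mulmxBr MM e1 e2 e3 subrr subr0.
  rewrite /=.
  have /matrixP/(_ i j) : map_mx eps (M - M *m N) = 0.
    by rewrite map_mxB map_mxM -eMN -map_mxM MM subrr.
  by rewrite [LHS]mxE [RHS]mxE.
move=> LL RR LR eLR; rewrite (half L R) // LR -half //.
Qed.

Lemma adic_unit u : eps u = 1 -> exists w, u * w = 1.
Proof.
move=> u1; have [|w] := adic_complete_unit (x := 1 - u) complA.
  by rewrite /= rmorphB rmorph1 u1 subrr.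
by rewrite opprB addrC subrK; exists w.
Qed.

(** The determinant reduces to 1, hence is a unit, and the adjugate formula gives the inverse. *)
Lemma adic_invertible_mx n (h : 'M[A]_n) : map_mx eps h = 1%:M ->
  exists g, [/\ g *m h = 1%:M, h *m g = 1%:M & map_mx eps g = 1%:M].
Proof.
move=> h1; have [|w dw] := @adic_unit (\det h); first by rewrite -det_map_mx h1 det1.
have hg : h *m (w *: \adj h) = 1%:M.
  by rewrite -scalemxAr mul_mx_adj scale_scalar_mx mulrC dw.
exists (w *: \adj h); split=> //.
  by rewrite -scalemxAl mul_adj_mx scale_scalar_mx mulrC dw.
by have := congr1 (map_mx eps) hg; rewrite map_mxM h1 mul1mx map_mx1.
Qed.

(** The rows of [h] are an adapted basis n, x, e lifting v_1, v_2, v_3. The conclusion is an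
    intertwining relation, which can be checked on products of these rows without the inverse of
    [h]. *)
Lemma codiff_normal_form (D : cochain 3 A) :
  odd_cochain par21 D -> codiff_identity par21 D -> map_mx eps D = d11 F ->
  exists2 t : A, eps t = 0 & exists h : 'M[A]_3,
    [/\ map_mx eps h = 1%:M, even_map par21 h &
        (h *t h) *m D = (d11 A + t *: psi A v2 v2 v3) *m h].
Proof.
move=> oddD codD epsD; pose T := shift par21 D.
have assoc a b c : bracket T (bracket T a b) c = bracket T a (bracket T b c).
  exact: shift_assoc.
have oddT : odd_cochain par21 T by apply: shift_odd.
pose del i : 'rV[A]_3 := delta_mx 0 i.
have hdel i : homogeneous par21 (par21 i) (del i) by apply: homogeneous_delta.
have del1 : homogeneous par21 false (del v1) := hdel v1.
have del2 : homogeneous par21 false (del v2) := hdel v2.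
have del3 : homogeneous par21 true (del v3) := hdel v3.
have map_del i : map_mx eps (del i) = delta_mx 0 i by apply: map_delta_mx.
pose T0 : cochain 3 F := shift par21 (pencil 1 0).
have map_bracketT a b :
    map_mx eps (bracket T a b) = bracket T0 (map_mx eps a) (map_mx eps b).
  by rewrite map_bracket map_shift epsD d11_pencil.
have map_coord (a : 'rV[A]_3) k : eps (a 0 k) = map_mx eps a 0 k by rewrite mxE.
have oddE z : homogeneous par21 true z -> z = z 0 v3 *: del v3.
  by move/homogeneous21E => [z1 z2]; apply/rowP; apply: ord3P;
    rewrite !mxE /= ?mulr0 ?mulr1.
(* The odd component is the line of v_3, so v_3 v_3 = u v_3 with [u] reducing to 1. If u w = 1, then
   e = w v_3 is idempotent. *)
pose u := bracket T (del v3) (del v3) 0 v3.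
have uE : bracket T (del v3) (del v3) = u *: del v3.
  by apply: oddE; apply: (oddT true true).
have [|w uw] := @adic_unit u.
  rewrite map_coord map_bracketT !map_del bracket_shift_pencil !mxE /=; ring.
have w1 : eps w = 1.
  have := congr1 eps uw; rewrite rmorphM rmorph1 map_coord map_bracketT !map_del.
  by rewrite bracket_shift_pencil !mxE /= => <-; ring.
pose e := w *: del v3.
have odde : homogeneous par21 true e by apply: homogeneousZ.
have ee : bracket T e e = e.
  by rewrite bracketZl bracketZr uE !scalerA -(mulrA w) (mulrC w u) uw mulr1.
have map_e : map_mx eps e = delta_mx 0 v3 by rewrite map_mxZ w1 scale1r map_del.
have oddEe z : homogeneous par21 true z -> z = (z 0 v3 * u) *: e.
  by move=> hz; rewrite scalerA -mulrA uw mulr1; apply: oddE.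
(* Associativity and e e = e make [L] and [R] commuting idempotents; they agree modulo the ideal by
   commutativity of the undeformed product. *)
pose L := lin1_mx (bracket T e); pose R := lin1_mx (bracketr T e).
have LE a : a *m L = bracket T e a by rewrite mul_rV_lin1.
have RE a : a *m R = bracket T a e by rewrite mul_rV_lin1.
have LR : L = R.
  apply: commuting_idempotent_mx_eq; apply: mulmx_rV_inj => a.
  - by rewrite mulmxA !LE -assoc ee.
  - by rewrite mulmxA !RE assoc ee.
  - by rewrite !mulmxA LE !RE LE assoc.
  - have mapL (b : 'rV[A]_3) :
        map_mx eps b *m map_mx eps L = map_mx eps b *m map_mx eps R.
      by rewrite -!map_mxM LE RE !map_bracketT bracket_shift_pencilC.
    rewrite (row_sum_delta a) !mulmx_suml.
    by apply: eq_bigr => i _; rewrite -!scalemxAl -map_del mapL.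
have eC a : bracket T a e = bracket T e a by rewrite -RE -LR LE.
(* Peirce components: [x] is the part of v_2 fixed by [e], and [n] is the part of v_1 killed by
   [e]. *)
pose x := bracket T e (del v2); pose n := del v1 - bracket T e (del v1).
have evx : homogeneous par21 false x by apply: (oddT true false).
have evn : homogeneous par21 false n.
  by apply: homogeneousB => //; apply: (oddT true false).
have ex : bracket T e x = x by rewrite /x -assoc ee.
have en : bracket T e n = 0.
  by rewrite /n (linearB (bracket T e)) /= -assoc ee subrr.
have odd_e z : homogeneous par21 true z -> bracket T e z = z.
  by move=> /oddEe ->; rewrite bracketZr ee.
(* A product of even vectors is odd, hence fixed by [e]; so n y = e (n y) = (e n) y = 0. *)
have ny y : homogeneous par21 false y -> bracket T n y = 0.
  move=> evy; rewrite -(odd_e (bracket T n y)); last exact: (oddT false false).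
  by rewrite -assoc en -[LHS]/(bracketr T y 0) linear0.
have yn y : homogeneous par21 false y -> bracket T y n = 0.
  move=> evy; rewrite -(odd_e (bracket T y n)); last exact: (oddT false false).
  by rewrite -eC assoc eC en linear0.
(* The factor [u] converts a v_3 coordinate into a coefficient of [e], since v_3 = u e. *)
pose s := bracket T x x 0 v3 * u.
have xx : bracket T x x = s *: e by apply: oddEe; apply: (oddT false false).
have map_x : map_mx eps x = delta_mx 0 v2.
  rewrite map_bracketT map_e map_del bracket_shift_pencil.
  by apply/rowP; apply: ord3P; rewrite !mxE /=; ring.
have map_n : map_mx eps n = delta_mx 0 v1.
  rewrite map_mxB map_bracketT map_e map_del bracket_shift_pencil.
  by apply/rowP; apply: ord3P; rewrite !mxE /=; ring.
(* The shifted product of d_11 + t psi^{22}_3 sends (v_2, v_2) to -t v_3, whence t = -s. *)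
exists (- s).
  rewrite rmorphN rmorphM map_coord map_bracketT map_x bracket_shift_pencil.
  by rewrite !mxE /=; ring.
pose hrow (i : 'I_3) := if i == v1 then n else if i == v2 then x else e.
pose h : 'M[A]_3 := \matrix_i hrow i.
have delh i : del i *m h = hrow i by rewrite -rowE rowK.
have evh : even_map par21 h.
  apply/even_mapP => i j ij.
  have -> : h i j = hrow i 0 j by rewrite mxE.
  move: i j ij.
  by apply: ord3P; apply: ord3P => // _;
    first [exact: evn | exact: evx | exact: odde].
exists h; split=> //.
  apply: mulmx_rV_inj => a; rewrite mulmx1 (row_sum_delta a) mulmx_suml.
  apply: eq_bigr => i _; rewrite -scalemxAl -map_del -map_mxM delh; congr (_ *: _).
  by move: i; apply: ord3P; rewrite map_del.
(* The multiplication table of n, x, e is compared with that of the shifted normal form on basis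
   vectors. *)
have shift_h i j : bracket T (del i *m h) (del j *m h) =
    bracket (shift par21 (pencil 1 (- s))) (del i) (del j) *m h.
  rewrite bracket_shift_pencil mulmxDl -!scalemxAl !delh /=.
  move: i j; apply: ord3P; apply: ord3P; rewrite /hrow !mxE /= ?(ee, eC) ?ex ?en;
    by rewrite ?ny ?yn // ?xx !(mul0r, mulr0, mul1r, mulr1, subr0, sub0r, addr0,
      add0r, scale0r, scale1r, opprK, oppr0).
have {}shift_h a b : bracket T (a *m h) (b *m h) =
    bracket (shift par21 (pencil 1 (- s))) a b *m h.
  rewrite -bracket_tensmx -bracket_mulmx; congr (bracket _ a b).
  by apply: cochain_ext => i j; rewrite bracket_tensmx bracket_mulmx.
rewrite pencil_d11; apply: cochain_ext => i j.
rewrite bracket_tensmx bracket_mulmx.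
(* The parity shift is undone by inserting the square of the involution, which commutes with the
   even map [h]. *)
rewrite -(mulmx1 (delta_mx 0 i)) -(shift_mxK par21 A) mulmxA.
by rewrite -bracket_shift -shift_h bracket_shift -!mulmxA (even_map_shift evh).
Qed.

End NormalForm.

(** * Miniversality of the deformation over power series *)

Lemma conjugatesP n (A : comNzRingType) (g h : 'M[A]_n) (D D' : cochain n A) :
  g *m h = 1%:M -> h *m g = 1%:M ->
  (forall a b, bracket D' a b *m g = bracket D (a *m g) (b *m g)) ->
  conjugates g D D'.
Proof.
move=> gh hg gD; exists h; split=> //; apply: cochain_ext => i j.
by rewrite bracket_mulmx bracket_tensmx -gD -mulmxA gh mulmx1.
Qed.

Lemma conjugates_bracket n (A : comNzRingType) (g : 'M[A]_n) (D D' : cochain n A) :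
  conjugates g D D' ->
  forall a b, bracket D' a b *m g = bracket D (a *m g) (b *m g).
Proof.
move=> [h [_ hg ->]] a b.
by rewrite bracket_mulmx bracket_tensmx -mulmxA hg mulmx1.
Qed.

Lemma odd_cochainD n (par : 'I_n -> bool) (A : comNzRingType) (C D : cochain n A) :
  odd_cochain par C -> odd_cochain par D -> odd_cochain par (C + D).
Proof.
move=> oddC oddD e f a b ha hb; rewrite bracketDmx.
by apply: homogeneousD; [apply: oddC|apply: oddD].
Qed.

Section Miniversality.
Context (K : fieldType).

Lemma aug_alg (B : comAlgType K) (eps : {lrmorphism B -> K^o}) (k : K) :
  eps k%:A = k.
Proof. by rewrite linearZ rmorph1; apply: mulr1. Qed.

Lemma in_alg_d11 (B : comAlgType K) : map_mx (in_alg B) (d11 K) = d11 B.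
Proof. by rewrite !d11_pencil map_pencil rmorph1 rmorph0. Qed.

Lemma push_forward_d_infty (B : comAlgType K) (f : {lrmorphism fps K -> B}) :
  push_forward f (d_infty K) = pencil 1 (f (fpsX K)).
Proof.
by rewrite /push_forward /d_infty in_alg_d11 pencil_d11 map_pencil rmorph1.
Qed.

Lemma d_infty_deformation : is_deformation par21 (fps_eps K) (d11 K) (d_infty K).
Proof.
split; first by rewrite d11_pencil; apply: pencil_codiff.
exists (fpsX K *: psi (fps K) v2 v2 v3); split=> //.
- move=> i j; rewrite /aug_ideal /= mxE rmorphM.
  by rewrite [X in X * _ = _](_ : _ = 0) ?mul0r.
- exact: psi223_odd.
- rewrite /d_infty in_alg_d11 pencil_d11.
  by case: (pencil_codiff (1 : fps K) (fpsX K)).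
Qed.

Lemma d_infty_versal : is_versal par21 (fps_eps K) (d11 K) (d_infty K).
Proof.
split; [exact: fps_is_formal_base|exact: d_infty_deformation|].
move=> B epsB dB [_ _ complB] [_ [phi [phi0 oddphi dBE codB]]].
have oddB : odd_cochain par21 dB.
  by rewrite dBE; apply: odd_cochainD => //; rewrite in_alg_d11 d11_pencil;
    apply: pencil_odd.
have epsdB : map_mx epsB dB = d11 K^o.
  rewrite dBE map_mxD in_alg_d11 d11_pencil map_pencil rmorph1 rmorph0 d11_pencil.
  by rewrite [X in _ + X](_ : _ = 0) ?addr0 //; apply/matrixP => i j;
    rewrite !mxE; apply: phi0.
have [t t0 [h [h1 evh hdB]]] := codiff_normal_form complB oddB codB epsdB.
have [g [gh hg g1]] := adic_invertible_mx complB h1.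
(* The classifying morphism is evaluation at [t], so it sends X to the parameter of the normal
   form. *)
exists (fps_eval complB t0).
  move=> a; apply/eqP; rewrite -subr_eq0; apply/eqP.
  rewrite -[fps_eps K a](aug_alg epsB) -rmorphB.
  exact: (ideal_pow_sub (ker_is_ideal epsB) (fps_eval_coef0 complB t0 a)).
(* Since (h (x) h) dB = d_A h in left-to-right composition, the equivalence from d_A to dB is the
   inverse [g] of [h]. *)
exists (g - 1%:M); split.
- move=> i j; have /matrixP/(_ i j) : map_mx epsB (g - 1%:M) = 0.
    by rewrite map_mxB g1 map_mx1 subrr.
  by rewrite [LHS]mxE [RHS]mxE.
- move=> e a ha; rewrite mulmxBr mulmx1; apply: homogeneousB => //.
  exact: even_map_inv gh hg evh _ _ ha.
rewrite addrC subrK; apply: (conjugatesP gh hg) => a b.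
have -> : bracket dB a b = bracket (pencil 1 t) (a *m g) (b *m g) *m h.
  by rewrite -pencil_d11 -bracket_mulmx -hdB bracket_tensmx -!mulmxA gh !mulmx1.
by rewrite -mulmxA hg mulmx1 push_forward_d_infty /= fps_evalX.
Qed.

(** At (v_2, v_2), evenness of lambda reduces the v_3 coordinate of the intertwining relation to s
    (1 + lambda_33) = t (1 + lambda_22)^2. Both s and t lie in the square-zero ideal, so the lambda
    terms disappear. *)
Lemma d_infty_obstruction (B : comAlgType K) (epsB : {lrmorphism B -> K^o})
    (dB : cochain 3 B) (t : B) :
  is_infinitesimal epsB -> epsB t = 0 -> def_equiv par21 epsB (pencil 1 t) dB ->
  bracket dB (delta_mx 0 v2) (delta_mx 0 v2) 0 v3 = t.
Proof.
move=> inf t0 [lam [lam0 evlam /conjugates_bracket gdB]].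
have sq0 (x y : B) : epsB x = 0 -> epsB y = 0 -> x * y = 0.
  move=> x0 y0; suff : ideal_pow (aug_ideal epsB) 2 (x * y) by rewrite inf.
  apply: ideal_powS => //; rewrite -[y]mulr1; exact: ideal_powS.
have /even_mapP lam_par := evlam.
set s := bracket dB _ _ 0 v3.
have rowE2 k :
    ((delta_mx 0 v2 : 'rV_3) *m (1%:M + lam)) 0 k = (v2 == k)%:R + lam v2 k.
  by rewrite -rowE !mxE.
have lam23 : lam v2 v3 = 0 by apply: lam_par.
have s_t : s * (1 + lam v3 v3) = t * (1 + lam v2 v2) ^+ 2.
  have /rowP/(_ v3) := gdB (delta_mx 0 v2) (delta_mx 0 v2).
  have [_ _ ->] := bracket_pencil_coord 1 t (delta_mx 0 v2 *m (1%:M + lam))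
    (delta_mx 0 v2 *m (1%:M + lam)).
  rewrite [LHS]mxE (bigD1 v3) //= big1 => [|i iv3].
    rewrite -/s [X in s * X]mxE [X in s * (X + _)]mxE addr0 !rowE2 lam23 /=.
    by rewrite !addr0 !mul0r mulr0 add0r expr2.
  have lam_i3 : lam i v3 = 0 by apply: lam_par; rewrite /par21 (negPf iv3).
  by rewrite [X in _ * X]mxE lam_i3 [X in _ * (X + _)]mxE (negPf iv3) addr0 mulr0.
have s0 : epsB s = 0.
  have := congr1 epsB s_t; rewrite !rmorphM !rmorphD !rmorph1 /= t0 mul0r.
  by rewrite (lam0 v3 v3) addr0 mulr1.
have lamE : forall i j, epsB (lam i j) = 0 := lam0.
have mul1lam x i : epsB x = 0 -> x * (1 + lam i i) = x.
  by move=> x0; rewrite mulrDr mulr1 sq0 ?addr0.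
by rewrite -[LHS](mul1lam s v3 s0) s_t expr2 mulrA !mul1lam.
Qed.

Lemma d_infty_miniversal : is_miniversal par21 (fps_eps K) (d11 K) (d_infty K).
Proof.
split; first exact: d_infty_versal.
move=> B epsB dB _ inf _ f1 f2 eps1 eps2; rewrite !push_forward_d_infty.
move=> /(d_infty_obstruction inf) dB1 /(d_infty_obstruction inf) dB2 a.
have f12 : f1 (fpsX K) = f2 (fpsX K) by rewrite -dB1 ?eps1 // dB2 ?eps2.
(* Splitting off one factor X replaces a continuity argument: f(X) and f1 b - f2 b both lie in the
   maximal ideal, so their product vanishes. *)
have shiftE (b : fps K) :
    b = (fps_coef b 0)%:A + fpsX K * Fps (fun i => fps_coef b i.+1).
  set c := Fps _; apply: fpsP => i; rewrite -[RHS]/(_ + fps_coef (fpsX K * c) i).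
  by rewrite fps_coefX; case: i => [|i]; rewrite /= ?mulr1 ?addr0 // mulr0 add0r.
have fE (f : {lrmorphism fps K -> B}) (k : K) (b : fps K) :
    f (k%:A + fpsX K * b) = k%:A + f (fpsX K) * f b.
  by rewrite rmorphD rmorphM /= linearZ rmorph1.
rewrite (shiftE a) !fE f12; congr (_ + _).
set b := Fps _; apply/eqP; rewrite -subr_eq0 -mulrBr; apply/eqP.
suff : ideal_pow (aug_ideal epsB) 2 (f2 (fpsX K) * (f1 b - f2 b)) by rewrite inf.
apply: ideal_powS; first by rewrite /aug_ideal /= eps2.
rewrite -[_ - _]mulr1; apply: ideal_powS => //.
by rewrite /aug_ideal /= rmorphB /= eps1 eps2 subrr.
Qed.

End Miniversality.

(** * The jump to d_1 *)

Lemma jump_equiv (K : fieldType) (t c : K) : t * c ^+ 2 = -1 ->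
  codiff_equiv par21 (d11 K + t *: psi K v2 v2 v3) (d1 K).
Proof.
move=> tc; have d1E : d1 K = pencil (-1) 1.
  by apply/matrixP => i j; rewrite !mxE; ring.
rewrite pencil_d11 d1E; split; [exact: pencil_codiff|exact: pencil_codiff|].
have c0 : c != 0.
  by apply: contra_eq_neq tc => ->; rewrite expr2 !mulr0 eq_sym oppr_eq0 oner_eq0.
(* The sign on v_3 changes d_11 into -d_11, and scaling v_2 by [c] turns the coefficient t of
   psi^{22}_3 into -t c^2 = 1. *)
pose diag3 (x : K) : 'M[K]_3 :=
  diag_mx (\row_i (if i == v1 then 1 else if i == v2 then x else -1)).
have diag3M x y : x * y = 1 -> diag3 x *m diag3 y = 1%:M.
  move=> xy; rewrite mulmx_diag -diag_const_mx; congr diag_mx.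
  by apply/rowP; apply: ord3P; rewrite !mxE /= ?xy //; ring.
exists (diag3 c).
  apply/even_mapP => i j ij; rewrite mxE; have [ij0|//] := eqVneq i j.
  by rewrite ij0 eqxx in ij.
apply: (@conjugatesP _ _ _ (diag3 c^-1)); rewrite ?diag3M ?mulfV ?mulVf // => a b.
have [L1 L2 L3] := bracket_pencil_coord (-1) 1 a b.
have [R1 R2 R3] := bracket_pencil_coord 1 t (a *m diag3 c) (b *m diag3 c).
have diag3E (d : 'rV[K]_3) i : (d *m diag3 c) 0 i =
    d 0 i * (if i == v1 then 1 else if i == v2 then c else -1).
  by rewrite mul_mx_diag !mxE.
apply/rowP; apply: ord3P; rewrite [LHS]diag3E /=.
- by rewrite L1 R1 mul0r.
- by rewrite L2 R2 !diag3E /=; ring.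
- by rewrite L3 R3 !diag3E /=; ring: tc.
Qed.

Theorem mainTheorem3 (R : realType) :
  is_miniversal par21 (fps_eps R[i]) (d11 R[i]) (d_infty R[i]) /\
  exists2 r : R[i], 0 < r &
    forall t : R[i], t != 0 -> `|t| < r ->
      codiff_equiv par21 (d11 R[i] + t *: psi R[i] v2 v2 v3) (d1 R[i]).
Proof.
split; first exact: d_infty_miniversal.
(* For every non-zero t, a square root c of -1/t solves t c^2 = -1; the radius 1 is an arbitrary
   choice. *)
exists 1 => // t t0 _; apply: (@jump_equiv _ _ (sqrtC (- t^-1))).
by rewrite sqrtCK mulrN mulfV.
Qed.
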